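(* For $\alpha\in[1,\infty]$ consider the following assertion: there is a constant $C>0$ such that $$\Big\|\sum_j\lambda_j\,|e^{it\Delta}P_{\le N}f_j|^2\Big\|_{L^2_tL^\infty_x(\mathbb T^{1+1})}\le C\,N^{\frac12}\,\|\lambda\|_{\ell^\alpha}\qquad(\ast)$$ for every $N>1$, every $\lambda=(\lambda_j)_j\in\ell^\alpha$ and every orthonormal system $(f_j)_j$ in $L^2(\mathbb T)$. Then $(\ast)$ holds whenever $\alpha\le2$, and $(\ast)$ fails whenever $\alpha>2$.
   Context: $\mathbb T=\mathbb R/\mathbb Z$; in $\mathbb T^{1+1}$ the variables are $(x,t)$ with $x,t\in\mathbb T$, and $\|F\|_{L^2_tL^\infty_x}=\big\|\,\|F(\cdot,t)\|_{L^\infty_x}\big\|_{L^2_t}$. $\hat f(n)$, $n\in\mathbb Z$, are the Fourier coefficients with respect to $e^{2\pi i xn}$. The free propagator is normalized by $e^{it\Delta}f(x)=\sum_{n\in\mathbb Z}\hat f(n)e^{2\pi i(xn+tn^2)}$, so it is $1$-periodic in $t$. The frequency cut-off is $P_{\le N}f(x)=\sum_{n\in\mathbb Z\cap[-N,N]}\hat f(n)e^{2\pi i xn}$. *)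

(* Defs.v *)
From HB Require Import structures.
From mathcomp Require Import all_boot all_order all_algebra.
From mathcomp Require Import complex.
From mathcomp Require Import all_classical all_reals all_analysis.

Set Implicit Arguments.
Unset Strict Implicit.
Unset Printing Implicit Defensive.

Import Order.TTheory GRing.Theory Num.Theory.
Import ComplexField.Normc.
Import numFieldNormedType.Exports.

Local Open Scope classical_set_scope.
Local Open Scope ring_scope.
Local Open Scope complex_scope.

Section torus.
Context {R : realType}.

(* Functions on R/Z are 1-periodic functions on the real line; their integrals
   and norms are taken over the fundamental domain [0, 1[. *)
Definition torus_measure : {measure set (measurableTypeR R) -> \bar R} :=
  mrestr (@lebesgue_measure R) (measurable_itv `[0%R, 1%R[).

Definition torus_integral (f : R -> R[i]) : R[i] :=
  (\int[torus_measure]_x complex.Re (f x)) +i* (\int[torus_measure]_x complex.Im (f x)).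

(* Square-integrable functions themselves, not classes modulo a.e. equality:
   everything below depends on them only through integrals. *)
Definition torus_L2 (f : R -> R[i]) : Prop :=
  [/\ forall x, f (x + 1) = f x,
      measurable_fun [set: measurableTypeR R] (fun x => complex.Re (f x)),
      measurable_fun [set: measurableTypeR R] (fun x => complex.Im (f x)) &
      ('N[torus_measure]_(2%:E) [(fun x => (normc (f x))%:E)] < +oo)%E].

Definition torus_inner (f g : R -> R[i]) : R[i] :=
  torus_integral (fun x => f x * (g x)^*).

Definition unit_exp (x : R) : R[i] := cos (2 * pi * x) +i* sin (2 * pi * x).

Definition fourier_coef (f : R -> R[i]) (n : int) : R[i] :=
  torus_integral (fun x => f x * unit_exp (- (x * n%:~R))).

Definition frequencies (N : R) : set int := [set n | - N <= n%:~R <= N].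

Definition freq_cutoff (N : R) (f : R -> R[i]) (x : R) : R[i] :=
  \sum_(n \in frequencies N) fourier_coef f n * unit_exp (x * n%:~R).

Definition climn (u : nat -> R[i]) : R[i] :=
  limn (fun n => complex.Re (u n)) +i* limn (fun n => complex.Im (u n)).

(* The series over all n in Z is the pointwise limit of its symmetric partial
   sums. For a general f in L^2 it would have to be taken in L^2, but below it
   is only applied to the trigonometric polynomials freq_cutoff N f, for which
   the partial sums are eventually constant. *)
Definition schrodinger (t : R) (f : R -> R[i]) (x : R) : R[i] :=
  climn (fun M : nat => \sum_(n \in frequencies M%:R)
    fourier_coef f n * unit_exp (x * n%:~R + t * n%:~R ^+ 2)).

(* Systems are indexed by an arbitrary set J of naturals, so that finite and
   countably infinite ones are both covered; L^2(R/Z) being separable, there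
   are no other orthonormal systems. *)
Definition orthonormal_system (J : set nat) (f : nat -> R -> R[i]) : Prop :=
  (forall j, J j -> torus_L2 (f j)) /\
  (forall j k, J j -> J k -> torus_inner (f j) (f k) = (j == k)%:R).

Definition ell_norm (alpha : \bar R) (J : set nat) (lambda : nat -> R[i]) :
    \bar R :=
  'N[counting]_alpha
    [(fun j => (if j \in J then normc (lambda j) else 0)%:E)]%E.

(* By Bessel's inequality the series converges absolutely as soon as lambda is
   bounded and f is orthonormal. *)
Definition density (N : R) (J : set nat) (lambda : nat -> R[i])
    (f : nat -> R -> R[i]) (x t : R) : R[i] :=
  climn (fun m => \sum_(0 <= j < m | j \in J)
    lambda j * `|schrodinger t (freq_cutoff N (f j)) x| ^+ 2).

Definition norm_L2t_Linftyx (F : R -> R -> R[i]) : \bar R :=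
  'N[torus_measure]_(2%:E) [(fun t =>
    'N[torus_measure]_(+oo) [(fun x => (normc (F x t))%:E)])]%E.

Definition maximal_estimate (alpha : \bar R) : Prop :=
  exists2 C : R, 0 < C &
    forall (N : R) (J : set nat) (lambda : nat -> R[i]) (f : nat -> R -> R[i]),
      1 < N -> (ell_norm alpha J lambda < +oo)%E -> orthonormal_system J f ->
      (norm_L2t_Linftyx (density N J lambda f)
        <= (C * Num.sqrt N)%:E * ell_norm alpha J lambda)%E.

End torus.

(* Main.v *)
Require Import Defs.
From mathcomp Require Import all_boot all_order all_algebra.
From mathcomp Require Import complex finmap ring lra zify.
From mathcomp Require Import all_classical all_reals all_analysis.
From mathcomp Require Import measurable_realfun ess_sup_inf.

(** Write a_j(n) for the Fourier coefficients of f_j.  The density is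
    rho(x,t) = sum_{m,n} G(m,n) e(x(m-n) + t(m^2-n^2)) over |m|,|n| <= N, where
    G(m,n) = sum_j lambda_j a_j(m) conj(a_j(n)), and Bessel's inequality bounds
    the Hilbert-Schmidt norm of G by the l^2 norm of lambda.  Grouping the terms
    by h = m - n removes the supremum over x:
    |rho(x,t)| <= sum_{|h| <= 2N} |sum_n G(n+h,n) e(2thn)|.
    By Parseval in t, the term of index h <> 0 has L^2_t norm equal to the l^2
    norm of the h-th diagonal of G; the term h = 0 does not depend on t and is
    at most N^(1/2) times, up to a constant, the l^2 norm of the main diagonal.
    Cauchy-Schwarz over the O(N) values of h gives the estimate for l^2, hence
    for l^alpha with alpha <= 2.  Conversely, the N + 1 plane waves e(jx),
    0 <= j <= N, with lambda_j = 1 have constant density N + 1, which exceeds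
    N^(1/2) (N+1)^(1/alpha) by an unbounded factor when alpha > 2. *)

Set Implicit Arguments.
Unset Strict Implicit.
Unset Printing Implicit Defensive.

Import Order.TTheory GRing.Theory Num.Theory.
Import ComplexField.Normc.
Import numFieldNormedType.Exports.

Local Open Scope classical_set_scope.
Local Open Scope complex_scope.
Local Open Scope ring_scope.

(** * Components, conjugates and moduli of complex numbers *)

Section complex_facts.
Context {R : rcfType}.
Implicit Types z w : R[i].

Lemma Re_addc z w : complex.Re (z + w) = complex.Re z + complex.Re w.
Proof. by case: z; case: w. Qed.

Lemma Im_addc z w : complex.Im (z + w) = complex.Im z + complex.Im w.
Proof. by case: z; case: w. Qed.

Lemma Re_mulc z w : complex.Re (z * w) =
  complex.Re z * complex.Re w - complex.Im z * complex.Im w.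
Proof. by case: z; case: w. Qed.

Lemma Im_mulc z w : complex.Im (z * w) =
  complex.Re z * complex.Im w + complex.Im z * complex.Re w.
Proof. by case: z; case: w. Qed.

Lemma normc_ge0 z : 0 <= normc z.
Proof. by case: z => a b; exact: sqrtr_ge0. Qed.

Lemma sqr_normcE z : normc z ^+ 2 = complex.Re z ^+ 2 + complex.Im z ^+ 2.
Proof. by case: z => a b /=; rewrite sqr_sqrtr// addr_ge0 ?sqr_ge0. Qed.

Lemma mulc_conj z : z * z^* = (normc z ^+ 2)%:C.
Proof.
rewrite sqr_normcE; case: z => a b; apply/eqP.
by rewrite eq_complex /=; apply/andP; split; apply/eqP; ring.
Qed.

Lemma Re_conjc z : complex.Re z^* = complex.Re z.
Proof. by case: z. Qed.

Lemma Im_conjc z : complex.Im z^* = - complex.Im z.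
Proof. by case: z. Qed.

Lemma normc_conj z : normc z^* = normc z.
Proof. by case: z => a b /=; rewrite sqrrN. Qed.

Lemma Re_le_normc z : `|complex.Re z| <= normc z.
Proof.
rewrite -(ler_pXn2r (ltn0Sn 1)) ?nnegrE ?normc_ge0//.
by rewrite sqr_normcE real_normK ?num_real// lerDl sqr_ge0.
Qed.

Lemma Im_le_normc z : `|complex.Im z| <= normc z.
Proof.
rewrite -(ler_pXn2r (ltn0Sn 1)) ?nnegrE ?normc_ge0//.
by rewrite sqr_normcE real_normK ?num_real// lerDr sqr_ge0.
Qed.

Lemma normc_sum (I : Type) (s : seq I) (P : pred I) (F : I -> R[i]) :
  normc (\sum_(i <- s | P i) F i) <= \sum_(i <- s | P i) normc (F i).
Proof.
apply: (big_ind2 (fun z (r : R) => normc z <= r)) => //.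
  by rewrite normc0.
by move=> x r y q xr yq; apply: le_trans (le_normcD x y) _; rewrite lerD.
Qed.

(** The two sums are conjugate to each other. In the kernel this trades [conj(a_j(n))] for [a_j(n)],
    to which Bessel's inequality applies. *)
Lemma normc_sum_conj (I : Type) (s : seq I) (u v : I -> R[i]) :
  normc (\sum_(i <- s) u i * (v i)^*) = normc (\sum_(i <- s) (u i)^* * v i).
Proof.
rewrite -[LHS]normc_conj rmorph_sum; congr normc.
by apply: eq_bigr => i _; rewrite rmorphM/= conjCK.
Qed.

End complex_facts.

(** * Square-integrable functions on the torus *)

Section torus_integral.
Context {R : realType}.
Local Notation mu := (@torus_measure R).
Implicit Types f g h : R -> R[i].

Lemma torus_measure_setT : mu setT = 1%E.
Proof.
rewrite /torus_measure /= /mrestr setTI lebesgue_measure_itv/= lte_fin ltr01.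
by rewrite oppr0 adde0.
Qed.

Definition cintegrable f :=
  mu.-integrable setT (EFin \o (fun x => complex.Re (f x))) /\
  mu.-integrable setT (EFin \o (fun x => complex.Im (f x))).

Lemma cintegrableD f g :
  cintegrable f -> cintegrable g -> cintegrable (fun x => f x + g x).
Proof.
move=> [fr fi] [gr gi]; split.
- under eq_fun do rewrite Re_addc.
  exact: (integrableD measurableT fr gr).
- under eq_fun do rewrite Im_addc.
  exact: (integrableD measurableT fi gi).
Qed.

Lemma torus_integralD f g : cintegrable f -> cintegrable g ->
  torus_integral (fun x => f x + g x) = torus_integral f + torus_integral g.
Proof.
move=> [fr fi] [gr gi]; rewrite /torus_integral.
by congr Complex; rewrite -RintegralD//; apply: eq_Rintegral => x _;
  rewrite ?Re_addc ?Im_addc.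
Qed.

Lemma integrable_lincomb (a b : R) (u v : R -> R) :
  mu.-integrable setT (EFin \o u) -> mu.-integrable setT (EFin \o v) ->
  mu.-integrable setT (EFin \o (fun x => a * u x + b * v x)).
Proof.
move=> iu iv; exact: (integrableD measurableT
  (integrableZl measurableT a iu) (integrableZl measurableT b iv)).
Qed.

Lemma Rintegral_lincomb (a b : R) (u v : R -> R) :
  mu.-integrable setT (EFin \o u) -> mu.-integrable setT (EFin \o v) ->
  \int[mu]_x (a * u x + b * v x) = a * (\int[mu]_x u x) + b * (\int[mu]_x v x).
Proof.
move=> iu iv; rewrite RintegralD// ?RintegralZl//.
  exact: (integrableZl measurableT a iu).
exact: (integrableZl measurableT b iv).
Qed.

Lemma cintegrableZ (c : R[i]) f : cintegrable f -> cintegrable (fun x => c * f x).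
Proof.
move=> [fr fi]; split.
- under eq_fun do rewrite Re_mulc -mulNr.
  exact: integrable_lincomb.
- under eq_fun do rewrite Im_mulc.
  exact: integrable_lincomb.
Qed.

Lemma torus_integralZ (c : R[i]) f : cintegrable f ->
  torus_integral (fun x => c * f x) = c * torus_integral f.
Proof.
move=> [fr fi]; rewrite /torus_integral.
under eq_Rintegral do rewrite Re_mulc -mulNr.
rewrite Rintegral_lincomb//.
under [X in _ +i* X]eq_Rintegral do rewrite Im_mulc.
by rewrite Rintegral_lincomb//; case: c => a b; rewrite mulNr.
Qed.

Lemma cintegrable0 : cintegrable (fun=> 0).
Proof. by split; exact: integrable0. Qed.

Lemma torus_integral0 : torus_integral (fun=> 0) = 0 :> R[i].
Proof. by rewrite /torus_integral /Rintegral /= !integral0. Qed.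

Lemma torus_integral_sum (I : eqType) (s : seq I) (F : I -> R -> R[i]) :
  (forall i, i \in s -> cintegrable (F i)) ->
  cintegrable (fun x => \sum_(i <- s) F i x) /\
  torus_integral (fun x => \sum_(i <- s) F i x) =
    \sum_(i <- s) torus_integral (F i).
Proof.
elim: s => [_|i s IH Fi].
  under eq_fun do rewrite big_nil.
  by rewrite big_nil; split; [exact: cintegrable0|exact: torus_integral0].
have [IH1 IH2] := IH (fun j js => Fi j (mem_behead (s := i :: s) js)).
have iFi := Fi i (mem_head _ _).
under eq_fun do rewrite big_cons.
rewrite big_cons -IH2; split; first exact: cintegrableD.
exact: torus_integralD.
Qed.

Lemma torus_integralJ f : cintegrable f ->
  torus_integral (fun x => (f x)^*) = (torus_integral f)^*.
Proof.
move=> [fr fi]; rewrite /torus_integral /=; congr Complex.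
  by apply: eq_Rintegral => x _; rewrite Re_conjc.
rewrite -mulN1r -RintegralZl//; apply: eq_Rintegral => x _.
by rewrite Im_conjc mulN1r.
Qed.

(** A form of square-integrability over one period that also covers [unit_exp (x * a)] for real [a],
    which need not be 1-periodic. *)
Definition sqintegrable f :=
  [/\ measurable_fun setT (fun x : measurableTypeR R => complex.Re (f x)),
      measurable_fun setT (fun x : measurableTypeR R => complex.Im (f x)) &
      mu.-integrable setT (EFin \o (fun x => normc (f x) ^+ 2))].

Lemma measurable_sqr_normc f :
  measurable_fun setT (fun x : measurableTypeR R => complex.Re (f x)) ->
  measurable_fun setT (fun x : measurableTypeR R => complex.Im (f x)) ->
  measurable_fun setT (fun x : measurableTypeR R => normc (f x) ^+ 2).
Proof.
move=> mr mi; under eq_fun do rewrite sqr_normcE.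
by apply: measurable_funD; exact: measurable_funX.
Qed.

Lemma torus_L2_sqintegrable f : torus_L2 f -> sqintegrable f.
Proof.
move=> [_ mr mi fin]; split => //; apply/integrableP; split.
  by apply/measurable_EFinP; exact: measurable_sqr_normc.
have : (('N[mu]_(2%:E)[(fun x => (normc (f x))%:E)]) `^ 2 < +oo)%E by exact: poweR_lty.
rewrite poweR_Lnorm ?pnatr_eq0//; apply: le_lt_trans.
rewrite le_eqVlt; apply/orP; left; apply/eqP; apply: eq_integral => x _ /=.
by rewrite powR_mulrn ?normr_ge0// normrX.
Qed.

(** Both components of the product are dominated by [|f|^2 + |g|^2]. *)
Lemma cintegrable_mulJ f g :
  sqintegrable f -> sqintegrable g -> cintegrable (fun x => f x * (g x)^*).
Proof.
move=> [fr fi fs] [gr gi gs].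
have fgs : mu.-integrable setT
    (EFin \o (fun x => 1 * normc (f x) ^+ 2 + 1 * normc (g x) ^+ 2)).
  exact: integrable_lincomb.
have fgb x : normc (f x * (g x)^*) <=
    `|1 * normc (f x) ^+ 2 + 1 * normc (g x) ^+ 2|.
  rewrite normcM normc_conj ger0_norm ?addr_ge0 ?mul1r ?sqr_ge0//.
  by have := sqr_ge0 (normc (f x) - normc (g x)); nra.
split; apply: (le_integrable _ _ _ fgs) => //.
- apply/measurable_EFinP; under eq_fun do rewrite Re_mulc Re_conjc Im_conjc.
  apply: measurable_funB; apply: measurable_funM => //.
  exact: measurableT_comp.
- by move=> x _; rewrite lee_fin; apply: le_trans (fgb x); exact: Re_le_normc.
- apply/measurable_EFinP; under eq_fun do rewrite Im_mulc Re_conjc Im_conjc.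
  apply: measurable_funD; apply: measurable_funM => //.
  exact: measurableT_comp.
- by move=> x _; rewrite lee_fin; apply: le_trans (fgb x); exact: Im_le_normc.
Qed.

(** The dominating function comes from [|f + g|^2 <= 2 |f|^2 + 2 |g|^2]. *)
Lemma sqintegrableD f g :
  sqintegrable f -> sqintegrable g -> sqintegrable (fun x => f x + g x).
Proof.
move=> [fr fi fs] [gr gi gs].
have mr : measurable_fun setT
    (fun x : measurableTypeR R => complex.Re (f x + g x)).
  by under eq_fun do rewrite Re_addc; exact: measurable_funD.
have mi : measurable_fun setT
    (fun x : measurableTypeR R => complex.Im (f x + g x)).
  by under eq_fun do rewrite Im_addc; exact: measurable_funD.
split => //.
apply: (le_integrable _ _ _ (integrable_lincomb 2 2 fs gs)) => //.
  by apply/measurable_EFinP; exact: measurable_sqr_normc.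
move=> x _; rewrite lee_fin.
rewrite !ger0_norm ?sqr_ge0 ?addr_ge0 ?mulr_ge0 ?sqr_ge0 ?normc_ge0//.
rewrite !sqr_normcE Re_addc Im_addc.
have := sqr_ge0 (complex.Re (f x) - complex.Re (g x)).
have := sqr_ge0 (complex.Im (f x) - complex.Im (g x)).
by lra.
Qed.

Lemma sqintegrableZ (c : R[i]) f :
  sqintegrable f -> sqintegrable (fun x => c * f x).
Proof.
move=> [fr fi fs].
have mr : measurable_fun setT (fun x : measurableTypeR R => complex.Re (c * f x)).
  under eq_fun do rewrite Re_mulc.
  by apply: measurable_funB; apply: measurable_funM.
have mi : measurable_fun setT (fun x : measurableTypeR R => complex.Im (c * f x)).
  under eq_fun do rewrite Im_mulc.
  by apply: measurable_funD; apply: measurable_funM.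
split => //.
under eq_fun do rewrite normcM exprMn.
exact: (integrableZl measurableT (normc c ^+ 2) fs).
Qed.

Lemma sqintegrable_sum (I : eqType) (s : seq I) (F : I -> R -> R[i]) :
  (forall i, i \in s -> sqintegrable (F i)) ->
  sqintegrable (fun x => \sum_(i <- s) F i x).
Proof.
elim: s => [_|i s IH Fi].
  under eq_fun do rewrite big_nil.
  split; [exact: measurable_cst|exact: measurable_cst|].
  under eq_fun do rewrite normc0 expr0n /=.
  exact: integrable0.
under eq_fun do rewrite big_cons.
apply: sqintegrableD; first by apply: Fi; rewrite mem_head.
by apply: IH => j js; apply: Fi; rewrite inE js orbT.
Qed.

Lemma torus_innerC f g : sqintegrable f -> sqintegrable g ->
  torus_inner g f = (torus_inner f g)^*.
Proof.
move=> sf sg; rewrite /torus_inner -torus_integralJ; last exact: cintegrable_mulJ.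
by congr torus_integral; apply/funext => x; rewrite rmorphM/= conjCK mulrC.
Qed.

Lemma torus_innerDl f g h : sqintegrable f -> sqintegrable g -> sqintegrable h ->
  torus_inner (fun x => f x + g x) h = torus_inner f h + torus_inner g h.
Proof.
move=> sf sg sh; rewrite /torus_inner -torus_integralD; [|exact: cintegrable_mulJ..].
by congr torus_integral; apply/funext => x; rewrite mulrDl.
Qed.

Lemma torus_innerZl (c : R[i]) f g : sqintegrable f -> sqintegrable g ->
  torus_inner (fun x => c * f x) g = c * torus_inner f g.
Proof.
move=> sf sg; rewrite /torus_inner -torus_integralZ; last exact: cintegrable_mulJ.
by congr torus_integral; apply/funext => x; rewrite mulrA.
Qed.

Lemma torus_inner_suml (I : eqType) (s : seq I) (c : I -> R[i])
    (F : I -> R -> R[i]) g :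
  (forall i, i \in s -> sqintegrable (F i)) -> sqintegrable g ->
  torus_inner (fun x => \sum_(i <- s) c i * F i x) g =
    \sum_(i <- s) c i * torus_inner (F i) g.
Proof.
move=> sF sg; rewrite /torus_inner.
transitivity (torus_integral (fun x => \sum_(i <- s) c i * (F i x * (g x)^*))).
  congr torus_integral; apply/funext => x; rewrite mulr_suml.
  by apply: eq_bigr => i _; rewrite mulrA.
have [|_ ->] := @torus_integral_sum _ s (fun i x => c i * (F i x * (g x)^*)).
  by move=> i /sF sFi; exact/cintegrableZ/cintegrable_mulJ.
rewrite big_seq [RHS]big_seq; apply: eq_bigr => i /sF sFi.
by rewrite torus_integralZ//; exact: cintegrable_mulJ.
Qed.

Lemma torus_inner_self f :
  torus_inner f f = (\int[mu]_x (normc (f x) ^+ 2))%:C.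
Proof.
rewrite /torus_inner /torus_integral; congr Complex.
  by apply: eq_Rintegral => x _; rewrite mulc_conj.
rewrite (@eq_Rintegral _ _ _ _ _ (fun=> 0)) => [|x _]; last by rewrite mulc_conj.
by rewrite /Rintegral /= integral0.
Qed.

(** The index type is left free, to serve both the exponentials, indexed by integers, and finite
    parts of the system, indexed by naturals. *)
Definition orthonormal_on (I : eqType) (s : seq I) (F : I -> R -> R[i]) :=
  (forall i, i \in s -> sqintegrable (F i)) /\
  (forall i j, i \in s -> j \in s -> torus_inner (F i) (F j) = (i == j)%:R).

(** Orthonormality picks out each coefficient; pairing the combination with itself then gives
    Pythagoras' identity. *)
Lemma torus_inner_lincomb (I : eqType) (s : seq I) (c : I -> R[i]) F :
  uniq s -> orthonormal_on s F ->
  (forall j, j \in s -> torus_inner (fun x => \sum_(i <- s) c i * F i x) (F j) = c j) /\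
  torus_inner (fun x => \sum_(i <- s) c i * F i x)
              (fun x => \sum_(i <- s) c i * F i x) =
  (\sum_(i <- s) normc (c i) ^+ 2)%:C.
Proof.
move=> us [sF oF]; have coef j : j \in s ->
    torus_inner (fun x => \sum_(i <- s) c i * F i x) (F j) = c j.
  move=> js; rewrite torus_inner_suml//; last exact: sF.
  rewrite big_seq (eq_bigr (fun i => c i * (i == j)%:R)); last first.
    by move=> i /oF ->.
  rewrite -big_seq (bigD1_seq j)//= eqxx mulr1 big1 ?addr0// => i /negbTE ->.
  by rewrite mulr0.
split => //; have sS : sqintegrable (fun x => \sum_(i <- s) c i * F i x).
  by apply: sqintegrable_sum => i /sF; exact: sqintegrableZ.
rewrite torus_inner_suml// rmorph_sum/= !big_seq; apply: eq_bigr => i si.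
by rewrite torus_innerC// ?coef// ?mulc_conj//; exact: sF.
Qed.

(** With [S] the projection of [g] on the span of the [F i], one has
    [0 <= ||g - S||^2 = ||g||^2 - sum |c_i|^2]. *)
Lemma bessel (I : eqType) (s : seq I) F g :
  uniq s -> orthonormal_on s F -> sqintegrable g ->
  \sum_(i <- s) normc (torus_inner g (F i)) ^+ 2 <= \int[mu]_x (normc (g x) ^+ 2).
Proof.
move=> us oF sg; pose c i := torus_inner g (F i).
pose S x := \sum_(i <- s) c i * F i x.
have [sF _] := oF.
have sS : sqintegrable S.
  by apply: sqintegrable_sum => i /sF; exact: sqintegrableZ.
have sNS : sqintegrable (fun x => -1 * S x) by exact: sqintegrableZ.
pose h x := g x + -1 * S x.
have sh : sqintegrable h by exact: sqintegrableD.
have [coef SS] := torus_inner_lincomb c us oF.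
have gS : torus_inner g S = (\sum_(i <- s) normc (c i) ^+ 2)%:C.
  rewrite torus_innerC// torus_inner_suml// rmorph_sum [RHS]rmorph_sum !big_seq.
  apply: eq_bigr => i /sF sFi.
  by rewrite [torus_inner (F i) g]torus_innerC// mulc_conj; exact: conjc_real.
(* The products [<g, S>], [<S, g>] and [<S, S>] all equal the same real sum, so one copy survives,
   with a minus sign. *)
have hh : torus_inner h h = torus_inner g g - (\sum_(i <- s) normc (c i) ^+ 2)%:C.
  rewrite torus_innerDl// torus_innerZl// [torus_inner g h]torus_innerC//.
  rewrite [torus_inner S h]torus_innerC// !torus_innerDl// !torus_innerZl//.
  rewrite SS gS [torus_inner S g]torus_innerC// gS torus_inner_self.
  move: (Rintegral _ _ _) (\sum_(i <- s) _) => a b.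
  by apply/eqP; rewrite eq_complex /=; apply/andP; split; apply/eqP; ring.
move: hh; rewrite !torus_inner_self -rmorphB/= => /complexI hh.
by rewrite -subr_ge0 -hh Rintegral_ge0// => x _; rewrite sqr_ge0.
Qed.

End torus_integral.

(** * Exponentials *)

Section exponentials.
Context {R : realType}.
Local Notation mu := (@torus_measure R).
Implicit Types (x y : R) (n m : int).

Lemma unit_expD x y : unit_exp (x + y) = unit_exp x * unit_exp y.
Proof.
rewrite /unit_exp mulrDr cosD sinD; apply/eqP.
by rewrite eq_complex /=; apply/andP; split; apply/eqP; ring.
Qed.

Lemma unit_expN x : unit_exp (- x) = (unit_exp x)^*.
Proof. by rewrite /unit_exp mulrN cosN sinN. Qed.

Lemma unit_exp0 : unit_exp 0 = 1 :> R[i].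
Proof. by rewrite /unit_exp mulr0 cos0 sin0. Qed.

Lemma normc_unit_exp x : normc (unit_exp x) = 1.
Proof. by rewrite /= cos2Dsin2 sqrtr1. Qed.

Lemma unit_exp_nat k : unit_exp k%:R = 1 :> R[i].
Proof.
rewrite /unit_exp (_ : 2 * pi * k%:R = 0 + pi *+ 2 *+ k).
  by rewrite (periodicn (@cosD2pi R)) (periodicn (@sinD2pi R)) cos0 sin0.
by rewrite add0r -[RHS]mulr_natr -[pi *+ 2]mulr_natr; ring.
Qed.

Lemma unit_exp_int n : unit_exp n%:~R = 1 :> R[i].
Proof.
case: n => k; first exact: unit_exp_nat.
by rewrite NegzE mulrNz unit_expN unit_exp_nat rmorph1.
Qed.

Lemma continuous_cos_linear (a b : R) : continuous (fun x => cos (a * x + b)).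
Proof.
move=> x; apply: continuous_comp; last exact: continuous_cos.
by apply: cvgD; [apply: cvgM; [exact: cvg_cst|exact: cvg_id]|exact: cvg_cst].
Qed.

Lemma continuous_sin_linear (a b : R) : continuous (fun x => sin (a * x + b)).
Proof.
move=> x; apply: continuous_comp; last exact: continuous_sin.
by apply: cvgD; [apply: cvgM; [exact: cvg_cst|exact: cvg_id]|exact: cvg_cst].
Qed.

Lemma sqintegrable_unit_exp (a : R) : sqintegrable (fun x => unit_exp (x * a)).
Proof.
have lin x : 2 * pi * (x * a) = 2 * pi * a * x + 0 by ring.
split.
- under eq_fun do rewrite /= lin.
  by apply: continuous_measurable_fun; exact: continuous_cos_linear.
- under eq_fun do rewrite /= lin.
  by apply: continuous_measurable_fun; exact: continuous_sin_linear.
- under eq_fun do rewrite normc_unit_exp expr1n.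
  apply/integrableP; split; first exact: measurable_cst.
  by rewrite integral_cst//= normr1 mul1e torus_measure_setT ltry.
Qed.

Lemma cintegrable_unit_exp (a : R) : cintegrable (fun x => unit_exp (x * a)).
Proof.
rewrite (_ : (fun x => _) = fun x => unit_exp (x * a) * (unit_exp (x * 0))^*).
  by apply: cintegrable_mulJ; exact: sqintegrable_unit_exp.
by apply/funext => x; rewrite -unit_expN mulr0 oppr0 unit_exp0 mulr1.
Qed.

(** The torus measure is Lebesgue measure cut to [[0, 1[]: dropping the null complement and adding
    the endpoint 1 leads to a closed interval, where the fundamental theorem of calculus applies. *)
Lemma Rintegral_torus_FTC (U u : R -> R) :
  (forall x, is_derive x 1 U (u x)) -> continuous u ->
  mu.-integrable setT (EFin \o u) ->
  \int[mu]_x u x = U 1 - U 0.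
Proof.
move=> dU cu iu; have mu_u : measurable_fun [set: measurableTypeR R] u.
  exact: continuous_measurable_fun.
have cU : continuous U.
  by move=> x; apply/differentiable_continuous/derivable1_diffP/ex_derive.
pose D : set (measurableTypeR R) := `[0%R, 1%R[%classic.
have mD : measurable D by exact: measurable_itv.
have torusD : (\int[mu]_x (u x)%:E = \int[mu]_(x in D) (u x)%:E)%E.
  have DC0 : mu (~` D) = 0%E.
    by rewrite /torus_measure /= /mrestr setICl measure0.
  rewrite -(setCK D) -setTD; apply: negligible_integral => //.
  exact: measurableC.
have lebD : (\int[mu]_(x in D) (u x)%:E = \int[lebesgue_measure]_(x in D) (u x)%:E)%E.
  apply: eq_measure_integral => A mA AD.
  by rewrite /torus_measure /= /mrestr setIidl.
rewrite /Rintegral torusD lebD integral_itv_bndo_bndc; last first.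
  exact/measurable_EFinP/measurable_funTS.
rewrite (@continuous_FTC2 _ _ U) ?ltr01//.
- exact/continuous_subspaceT.
- split=> [x _| |].
  + exact: ex_derive.
  + exact/cvg_at_right_filter/cU.
  + exact/cvg_at_left_filter/cU.
- by move=> x _; rewrite derive1E derive_val.
Qed.

(** For [n != 0] the components have antiderivatives [sin (w x) / w] and [- cos (w x) / w] with
    [w = 2 pi n], which take equal values at 0 and 1. *)
Lemma torus_integral_unit_exp n :
  torus_integral (fun x => unit_exp (x * n%:~R)) = (n == 0)%:R :> R[i].
Proof.
have [->|n0] := eqVneq n 0.
  under eq_fun do rewrite mulr0 unit_exp0.
  rewrite /torus_integral /= Rintegral_cst// torus_measure_setT mulr1.
  by rewrite Rintegral_cst// mul0r.
pose w : R := 2 * pi * n%:~R.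
have w0 : w != 0 by rewrite !mulf_neq0 ?pnatr_eq0 ?intr_eq0// gt_eqF ?pi_gt0.
have lin x : 2 * pi * (x * n%:~R) = w * x + 0 by rewrite /w; ring.
have [c1 s1] : unit_exp (1 * n%:~R) = 1 :> R[i] by rewrite mul1r unit_exp_int.
move: c1 s1; rewrite lin => c1 s1.
have := cintegrable_unit_exp n%:~R; have -> : (fun x => unit_exp (x * n%:~R)) =
    (fun x => cos (w * x + 0) +i* sin (w * x + 0)).
  by apply/funext => x; rewrite /unit_exp lin.
move=> [icos isin]; rewrite /torus_integral; congr Complex.
- have dU x : is_derive x 1 (fun y => w^-1 * sin (w * y + 0)) (cos (w * x + 0)).
    apply: is_derive_eq.
    by rewrite /GRing.scale /=; field.
  apply: etrans (Rintegral_torus_FTC dU (@continuous_cos_linear _ _) icos) _.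
  by rewrite s1 [w * 0]mulr0 add0r sin0 subrr.
- have dU x : is_derive x 1 (fun y => - w^-1 * cos (w * y + 0)) (sin (w * x + 0)).
    apply: is_derive_eq.
    by rewrite /GRing.scale /=; field.
  apply: etrans (Rintegral_torus_FTC dU (@continuous_sin_linear _ _) isin) _.
  by rewrite c1 [w * 0]mulr0 add0r cos0 subrr.
Qed.

Lemma torus_inner_unit_exp n m :
  torus_inner (fun x => unit_exp (x * n%:~R)) (fun x => unit_exp (x * m%:~R)) =
  (n == m)%:R :> R[i].
Proof.
rewrite -subr_eq0 -torus_integral_unit_exp; congr torus_integral.
by apply/funext => x; rewrite -unit_expN -unit_expD -mulrBr intrB.
Qed.

End exponentials.

(** * Frequency sets, complex limits and the evolution of the cut-off *)

Section frequencies.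
Context {R : realType}.
Implicit Types (N x t : R) (n m : int) (f : R -> R[i]).

Definition freqs N : seq int := fset_set (frequencies N).

(** The explicit list of [2 K + 1] integers, [K] being the integer part of [|N|], yields both
    finiteness and, for [N >= 0], the count in [size_freqs]. *)
Lemma frequencies_sub N n : frequencies N n ->
  n \in [seq k%:Z - (Num.truncn `|N|)%:Z | k <- iota 0 (Num.truncn `|N|).*2.+1].
Proof.
move=> /andP[Nn nN]; set K := Num.truncn _.
have nK : (`|n|%N <= K)%N.
  rewrite truncn_ge_nat//.
  have -> : (`|n|%N)%:R = `|n%:~R| :> R by rewrite -intr_norm -abszE.
  by rewrite (le_trans _ (ler_norm N))// ler_norml Nn.
by apply/mapP; exists `|(n + K%:Z)%R|%N; rewrite ?mem_iota; lia.
Qed.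

Lemma finite_frequencies N : finite_set (frequencies N).
Proof. exact: sub_finite_set (@frequencies_sub N) (finite_seq _). Qed.

Lemma mem_freqs N n : (n \in freqs N) = (- N <= n%:~R <= N).
Proof.
rewrite /freqs in_fset_set; last exact: finite_frequencies.
by apply/idP/idP => [|h]; rewrite inE.
Qed.

Lemma uniq_freqs N : uniq (freqs N).
Proof. exact: fset_uniq. Qed.

Lemma size_freqs N : 0 <= N -> (size (freqs N))%:R <= 2 * N + 1.
Proof.
move=> N0; have : (size (freqs N) <= (Num.truncn N).*2.+1)%N.
  rewrite -[leqRHS](size_iota 0) -(size_map (fun k : nat => k%:Z - (Num.truncn N)%:Z)).
  apply: uniq_leq_size (uniq_freqs N) _ => n.
  rewrite mem_freqs => nN; have := @frequencies_sub N n nN.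
  by rewrite ger0_norm.
rewrite -(ler_nat R) => /le_trans; apply.
rewrite -addn1 natrD -muln2 natrM mulrC lerD2r ler_pM2l//.
by rewrite truncn_le.
Qed.

Lemma fsum_freqs N (F : int -> R[i]) :
  \sum_(n \in frequencies N) F n = \sum_(n <- freqs N) F n.
Proof. by rewrite fsbig_finite//; exact: finite_frequencies. Qed.

Lemma orthonormal_unit_exp (s : seq int) :
  orthonormal_on s (fun n x => unit_exp (x * n%:~R) : R[i]).
Proof.
by split=> *; [exact: sqintegrable_unit_exp|exact: torus_inner_unit_exp].
Qed.

Lemma fourier_coefE f n :
  fourier_coef f n = torus_inner f (fun x => unit_exp (x * n%:~R)).
Proof.
by congr torus_integral; apply/funext => x; rewrite unit_expN.
Qed.

Lemma fourier_coef_cutoff N f n : fourier_coef (freq_cutoff N f) n =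
  if n \in freqs N then fourier_coef f n else 0.
Proof.
rewrite fourier_coefE.
have -> : freq_cutoff N f =
    (fun x => \sum_(m <- freqs N) fourier_coef f m * unit_exp (x * m%:~R)).
  by apply/funext => x; rewrite /freq_cutoff fsum_freqs.
have [coef _] := torus_inner_lincomb (fourier_coef f) (uniq_freqs N)
  (orthonormal_unit_exp (freqs N)).
case: ifPn => [/coef //|nN].
rewrite torus_inner_suml; [|by move=> *; exact: sqintegrable_unit_exp..].
rewrite big_seq big1// => m mN; rewrite torus_inner_unit_exp.
by case: eqP mN nN => [-> ->//|_ _ _]; rewrite mulr0.
Qed.

(** Convergence is taken component by component to match [climn]. *)
Definition ccvg (u : nat -> R[i]) (l : R[i]) :=
  (fun k => complex.Re (u k)) @ \oo --> complex.Re l /\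
  (fun k => complex.Im (u k)) @ \oo --> complex.Im l.

Lemma climnE u l : ccvg u l -> climn u = l.
Proof.
move=> [ur ui]; rewrite /climn (cvg_lim (@Rhausdorff R) ur).
by rewrite (cvg_lim (@Rhausdorff R) ui); case: l ur ui.
Qed.

Lemma ccvg_near_cst (u : nat -> R[i]) l : (\forall k \near \oo, u k = l) -> ccvg u l.
Proof.
by move=> ul; split; apply: cvg_near_cst; apply: filterS ul => k ->.
Qed.

Lemma ccvgD u v a b : ccvg u a -> ccvg v b -> ccvg (fun k => u k + v k) (a + b).
Proof.
move=> [ur ui] [vr vi]; split.
  by rewrite Re_addc; under eq_fun do rewrite Re_addc; exact: cvgD.
by rewrite Im_addc; under eq_fun do rewrite Im_addc; exact: cvgD.
Qed.

Lemma ccvgMr u a (c : R[i]) : ccvg u a -> ccvg (fun k => u k * c) (a * c).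
Proof.
move=> [ur ui]; split.
  rewrite Re_mulc; under eq_fun do rewrite Re_mulc.
  by apply: cvgB; apply: cvgMl.
rewrite Im_mulc; under eq_fun do rewrite Im_mulc.
by apply: cvgD; apply: cvgMl.
Qed.

Lemma ccvg_sum (I : Type) (s : seq I) (u : I -> nat -> R[i]) l :
  (forall i, ccvg (u i) (l i)) ->
  ccvg (fun k => \sum_(i <- s) u i k) (\sum_(i <- s) l i).
Proof.
move=> ul; elim: s => [|i s IH].
  by apply: ccvg_near_cst; apply: nearW => k; rewrite !big_nil.
rewrite big_cons; under eq_fun do rewrite big_cons.
exact: ccvgD.
Qed.

Lemma ccvg_sqr_normc u l : ccvg u l ->
  (fun k => normc (u k) ^+ 2) @ \oo --> normc l ^+ 2.
Proof.
move=> [ur ui]; rewrite sqr_normcE; under eq_fun do rewrite sqr_normcE !expr2.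
by rewrite !expr2; apply: cvgD; apply: cvgM.
Qed.

(** Absolute convergence: each component is dominated by the modulus, so the sums of its absolute
    values are nondecreasing and bounded by [B]. *)
Lemma ccvg_series (u : nat -> R[i]) (B : R) :
  (forall M, \sum_(0 <= j < M) normc (u j) <= B) ->
  exists l, ccvg (fun M => \sum_(0 <= j < M) u j) l.
Proof.
move=> uB; have cvg_of (p : R[i] -> R) : (forall z, `|p z| <= normc z) ->
    p 0 = 0 -> {morph p : z w / z + w} ->
    cvgn (fun M => p (\sum_(0 <= j < M) u j)).
  move=> pn p0 pD.
  have -> : (fun M => p (\sum_(0 <= j < M) u j)) = series (fun j => p (u j)).
    by apply/funext => M; rewrite /series /= (big_morph _ pD p0).
  apply: normed_cvg; apply: nondecreasing_is_cvgn.
    by apply: nondecreasing_series => *; exact: normr_ge0.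
  exists B => _ [M _ <-]; apply: le_trans (uB M).
  by apply: ler_sum => j _; exact: pn.
have re := cvg_of _ Re_le_normc erefl Re_addc.
have im := cvg_of _ Im_le_normc erefl Im_addc.
by exists (limn (fun M => complex.Re (\sum_(0 <= j < M) u j)) +i*
  limn (fun M => complex.Im (\sum_(0 <= j < M) u j))); split.
Qed.

Definition wave n x t : R[i] := unit_exp (x * n%:~R + t * n%:~R ^+ 2).

(** Once [M >= N] the symmetric partial sums no longer change. *)
Lemma schrodinger_cutoff N f x t :
  schrodinger t (freq_cutoff N f) x =
  \sum_(n <- freqs N) fourier_coef f n * wave n x t.
Proof.
apply: climnE; apply: ccvg_near_cst.
near=> M; have NM : N <= M%:R by near: M; exact: nbhs_infty_ger.
rewrite fsum_freqs.
under eq_bigr do rewrite fourier_coef_cutoff (fun_if (fun z => z * _)) mul0r.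
rewrite -big_mkcond -big_filter; apply: perm_big.
apply: uniq_perm; rewrite ?filter_uniq ?uniq_freqs// => n.
rewrite mem_filter !mem_freqs; apply: andb_idr => /andP[Nn nN].
by rewrite (le_trans nN NM) andbT; apply: le_trans Nn; rewrite lerN2.
Unshelve. all: by end_near. Qed.

End frequencies.

(** * The kernel of the density *)

Section density_kernel.
Context {R : realType}.
Variables (f : nat -> R -> R[i]).
Implicit Types (N x t : R) (n m : int) (lambda : nat -> R[i]).
Local Notation a := (fun j n => fourier_coef (f j) n).

(** Bessel for the exponentials, applied to [g = sum_j b_j f_j], whose squared norm is
    [sum_j |b_j|^2] by Pythagoras. *)
Lemma sum_sqr_coef_lincomb (s : seq nat) (F : seq int) (b : nat -> R[i]) :
  uniq s -> orthonormal_on s f -> uniq F ->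
  \sum_(n <- F) normc (\sum_(j <- s) b j * a j n) ^+ 2 <=
  \sum_(j <- s) normc (b j) ^+ 2.
Proof.
move=> us of_ uF; have [sf _] := of_; pose g x := \sum_(j <- s) b j * f j x.
have sg : sqintegrable g.
  by apply: sqintegrable_sum => j /sf; exact: sqintegrableZ.
have [_] := torus_inner_lincomb b us of_.
rewrite torus_inner_self => /complexI <-.
apply: le_trans (bessel uF (orthonormal_unit_exp F) sg).
apply: ler_sum => n _.
rewrite torus_inner_suml//; last exact: sqintegrable_unit_exp.
by under eq_bigr do rewrite fourier_coefE.
Qed.

Lemma sum_sqr_coef_le1 j (F : seq int) :
  orthonormal_on [:: j] f -> uniq F -> \sum_(n <- F) normc (a j n) ^+ 2 <= 1.
Proof.
move=> oj uF; have := sum_sqr_coef_lincomb (s := [:: j]) (fun=> 1) isT oj uF.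
rewrite big_seq1 normc1 expr1n; apply: le_trans; apply: ler_sum => n _.
by rewrite big_seq1 mul1r.
Qed.

(* Bessel for the exponentials, applied for each fixed m to the function
   sum_j conj(lambda_j a_j(m)) f_j. *)
Lemma sum_sqr_density_kernel (s : seq nat) (F : seq int) lambda :
  uniq s -> orthonormal_on s f -> uniq F ->
  \sum_(m <- F) \sum_(n <- F)
     normc (\sum_(j <- s) lambda j * (a j m * (a j n)^*)) ^+ 2 <=
  \sum_(j <- s) normc (lambda j) ^+ 2.
Proof.
move=> us of_ uF.
apply: (@le_trans _ _ (\sum_(m <- F) \sum_(j <- s)
    normc (lambda j) ^+ 2 * normc (a j m) ^+ 2)).
  apply: ler_sum => m _.
  have := sum_sqr_coef_lincomb (fun j => (lambda j * a j m)^*) us of_ uF.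
  under [leRHS]eq_bigr do rewrite normc_conj normcM exprMn.
  apply: le_trans; apply: ler_sum => n _.
  by under eq_bigr do rewrite mulrA; rewrite normc_sum_conj.
(* Summing over [m] first, Bessel for the single function [f_j] gives [sum_m |a_j(m)|^2 <= 1]. *)
rewrite exchange_big/= big_seq [leRHS]big_seq; apply: ler_sum => j js.
rewrite -mulr_sumr ler_piMr ?sqr_ge0//; apply: sum_sqr_coef_le1 => //.
have [sf orf] := of_.
by split=> [i|i k]; rewrite !inE => /eqP ->; [exact: sf|move=> /eqP ->; exact: orf].
Qed.

End density_kernel.

(** * Passage to the limit in the number of functions *)

Section density_kernel_limit.
Context {R : realType}.
Variables (f : nat -> R -> R[i]) (J : set nat) (lambda : nat -> R[i]).
Hypothesis of_ : orthonormal_system J f.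
Local Notation a := (fun j n => fourier_coef (f j) n).

Let js M := [seq j <- index_iota 0 M | j \in J].

Let sum_js (V : nmodType) M (F : nat -> V) :
  \sum_(0 <= j < M) (if j \in J then F j else 0) = \sum_(j <- js M) F j.
Proof. by rewrite -big_mkcond big_filter. Qed.

Let orthonormal_js M : orthonormal_on (js M) f.
Proof.
have [sf orf] := of_; split=> [j|j k]; rewrite !mem_filter.
  by move=> /andP[/set_mem Jj _]; exact/torus_L2_sqintegrable/sf.
by move=> /andP[/set_mem Jj _] /andP[/set_mem Jk _]; exact: orf.
Qed.

Let uniq_js M : uniq (js M).
Proof. exact/filter_uniq/iota_uniq. Qed.

Let orthonormal_seq1 j : j \in J -> orthonormal_on [:: j] f.
Proof.
move=> /set_mem Jj; have [sf orf] := of_.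
split=> [i|i k]; rewrite !inE => /eqP ->.
  exact/torus_L2_sqintegrable/sf.
by move=> /eqP ->; exact: orf.
Qed.

(** Here Bessel runs the other way: the orthonormal family is a finite part of [(f_j)], and the
    function expanded is the exponential of frequency [n], of norm 1. *)
Let sum_sqr_coef_js M n : \sum_(j <- js M) normc (a j n) ^+ 2 <= 1.
Proof.
have sE := @sqintegrable_unit_exp R n%:~R.
have := bessel (uniq_js M) (orthonormal_js M) sE.
under [leRHS]eq_Rintegral do rewrite normc_unit_exp expr1n.
rewrite Rintegral_cst// mul1r torus_measure_setT; apply: le_trans.
rewrite big_seq [leRHS]big_seq; apply: ler_sum => j jM.
have [sf _] := orthonormal_js M.
by rewrite fourier_coefE torus_innerC ?normc_conj//; exact: sf.
Qed.

(** [G m n] is the limit of the sums of [lambda_j a_j(m) conj(a_j(n))] over [j < M] in [J]. The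
    Hilbert-Schmidt bound holds for every [M] and survives the limit because only finitely many
    frequencies occur. *)
Lemma density_kernel_limit (N B : R) :
  (forall M, \sum_(0 <= j < M | j \in J) normc (lambda j) ^+ 2 <= B) ->
  exists G : int -> int -> R[i],
    (forall x t, density N J lambda f x t =
      \sum_(m <- freqs N) \sum_(n <- freqs N)
        G m n * (wave m x t * (wave n x t)^*)) /\
    \sum_(m <- freqs N) \sum_(n <- freqs N) normc (G m n) ^+ 2 <= B.
Proof.
move=> lB.
pose u m n j := if j \in J then lambda j * (a j m * (a j n)^*) else 0.
have uE m n M : \sum_(0 <= j < M) u m n j =
    \sum_(j <- js M) lambda j * (a j m * (a j n)^*) by exact: sum_js.
(* Since [|a_j(n)| <= 1], each term is at most [|lambda_j|^2 + |a_j(m)|^2]; the two sums are bounded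
   by [B] and, by Bessel, by 1. *)
have ubound m n M : \sum_(0 <= j < M) normc (u m n j) <= B + 1.
  under eq_bigr do rewrite /u (fun_if (@normc R)) normc0.
  rewrite sum_js.
  apply: (@le_trans _ _ (\sum_(j <- js M) (normc (lambda j) ^+ 2 + normc (a j m) ^+ 2))).
    rewrite big_seq [leRHS]big_seq; apply: ler_sum => j.
    rewrite mem_filter => /andP[jJ _].
    have := @sum_sqr_coef_le1 R f j [:: n] (orthonormal_seq1 jJ) isT.
    rewrite big_seq1 !normcM normc_conj => an1.
    have {}an1 : normc (a j n) <= 1 by rewrite -(@expr_le1 _ 2) ?normc_ge0.
    have := normc_ge0 (a j n); have := normc_ge0 (a j m).
    have := normc_ge0 (lambda j).
    move: (normc _) (normc _) (normc _) an1 => p q r r1 p0 q0 r0.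
    rewrite mulrA (le_trans (ler_piMr _ r1)) ?mulr_ge0//.
    by have := sqr_ge0 (p - q); nra.
  rewrite big_split/=; apply: lerD; last exact: sum_sqr_coef_js.
  by rewrite big_filter.
have /choice[G0 G0P] p : exists l, ccvg (fun M => \sum_(0 <= j < M) u p.1 p.2 j) l.
  exact: ccvg_series (ubound p.1 p.2).
pose G m n := G0 (m, n).
have GP m n : ccvg (fun M => \sum_(0 <= j < M) u m n j) (G m n) by exact: (G0P (m, n)).
exists G; split.
  move=> x t; apply: climnE.
  (* Each squared modulus expands into a double sum over frequencies; exchanging finite sums brings
     out the partial sums of the kernel. *)
  have -> : (fun M => \sum_(0 <= j < M | j \in J)
        lambda j * `|schrodinger t (freq_cutoff N (f j)) x| ^+ 2) =
      (fun M => \sum_(m <- freqs N) \sum_(n <- freqs N)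
        (\sum_(0 <= j < M) u m n j) * (wave m x t * (wave n x t)^*)).
    apply/funext => M; rewrite -big_filter.
    under eq_bigr => j _.
      rewrite schrodinger_cutoff normCK rmorph_sum mulr_suml mulr_sumr.
      under eq_bigr do rewrite mulr_sumr mulr_sumr.
      over.
    rewrite exchange_big; apply: eq_bigr => m _.
    rewrite exchange_big; apply: eq_bigr => n _.
    rewrite uE mulr_suml; apply: eq_bigr => j _.
    by rewrite rmorphM; ring.
  by apply: ccvg_sum => m; apply: ccvg_sum => n; exact: ccvgMr.
have cvgS : (fun M => \sum_(m <- freqs N) \sum_(n <- freqs N)
      normc (\sum_(0 <= j < M) u m n j) ^+ 2) @ \oo -->
    \sum_(m <- freqs N) \sum_(n <- freqs N) normc (G m n) ^+ 2.
  apply: cvg_big; [exact: add_continuous|] => m _.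
  apply: cvg_big; [exact: add_continuous|] => n _.
  exact: ccvg_sqr_normc.
rewrite -(cvg_lim (@Rhausdorff R) cvgS); apply: limr_le.
  by apply/cvg_ex; eexists; exact: cvgS.
apply: nearW => M.
under eq_bigr do under eq_bigr do rewrite uE.
apply: le_trans
  (sum_sqr_density_kernel _ (uniq_js M) (orthonormal_js M) (uniq_freqs N)) _.
by rewrite big_filter.
Qed.

End density_kernel_limit.

(** * The mixed norm of the density *)

Section mixed_norm_bound.
Context {R : realType}.
Local Notation mu := (@torus_measure R).
Implicit Types (N x t : R).

(** Cauchy-Schwarz against the constant 1, by induction; cross terms are absorbed by
    [2 u_i u_j <= u_i^2 + u_j^2]. *)
Lemma sqr_sum_le (I : Type) (s : seq I) (u : I -> R) :
  (\sum_(i <- s) u i) ^+ 2 <= (size s)%:R * \sum_(i <- s) u i ^+ 2.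
Proof.
elim: s => [|i s IH]; first by rewrite !big_nil expr0n mulr0.
rewrite !big_cons /= -natr1; move: IH.
have : 2 * (u i * \sum_(j <- s) u j) <=
    (size s)%:R * u i ^+ 2 + \sum_(j <- s) u j ^+ 2.
  have -> : (size s)%:R * u i ^+ 2 = \sum_(j <- s) u i ^+ 2.
    by rewrite big_const_seq count_predT iter_addr_0 mulr_natl.
  rewrite -big_split mulrA mulr_sumr; apply: ler_sum => j _ /=.
  by have := sqr_ge0 (u i - u j); nra.
by move: (\sum_(j <- s) u j) (\sum_(j <- s) _) (size s)%:R => p q r; nra.
Qed.

(** From [(n + h)^2 - n^2 = h^2 + 2 h n]: all dependence on [x] sits in a factor of modulus 1 that
    is independent of [n]. *)
Lemma wave_mulJ (n h : int) x t :
  wave (n + h) x t * (wave n x t)^* =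
  unit_exp (x * h%:~R + t * h%:~R ^+ 2) * unit_exp (t * (2 * h * n)%:~R).
Proof.
rewrite /wave -unit_expN -!unit_expD; congr unit_exp.
by rewrite !intrM intrD; ring.
Qed.

(** Differences of two points of [[-N, N]] lie in [[-2N, 2N]]. Padding with zeros makes the range of
    [h] independent of [n], so that the sums over [h] and [n] can be exchanged. *)
Lemma sum_freqs_shift (V : nmodType) N (n : int) (F : int -> V) :
  n \in freqs N ->
  \sum_(m <- freqs N) F m =
  \sum_(h <- freqs (2 * N)) (if n + h \in freqs N then F (n + h) else 0).
Proof.
move=> nN; rewrite -big_mkcond -big_filter -(big_map (fun h => n + h) xpredT F).
apply: perm_big; apply: uniq_perm; rewrite ?uniq_freqs//.
  by rewrite map_inj_uniq ?filter_uniq ?uniq_freqs//; exact: addrI.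
move=> m; apply/idP/mapP => [mN|[h + ->]]; last by rewrite mem_filter => /andP[].
exists (m - n); last by rewrite addrC subrK.
rewrite mem_filter [n + _]addrC subrK mN/=; move: mN nN; rewrite !mem_freqs.
by rewrite intrB => /andP[? ?] /andP[? ?]; apply/andP; split; lra.
Qed.

(** Parseval: as [k != 0], distinct [n] give distinct frequencies [k n], hence orthonormal
    exponentials. *)
Lemma Rintegral_sqr_normc_lincomb (s : seq int) (c : int -> R[i]) (k : int) :
  uniq s -> k != 0 ->
  mu.-integrable setT
    (EFin \o (fun t => normc (\sum_(n <- s) c n * unit_exp (t * (k * n)%:~R)) ^+ 2)) /\
  \int[mu]_t (normc (\sum_(n <- s) c n * unit_exp (t * (k * n)%:~R)) ^+ 2) =
  \sum_(n <- s) normc (c n) ^+ 2.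
Proof.
move=> us k0.
have on : orthonormal_on s (fun n t => unit_exp (t * (k * n)%:~R) : R[i]).
  split=> [n _|n m _ _]; first exact: sqintegrable_unit_exp.
  by rewrite torus_inner_unit_exp (inj_eq (mulfI k0)).
have [_] := torus_inner_lincomb c us on.
rewrite torus_inner_self => /complexI ->; split => //.
have [_ _] // : sqintegrable
    (fun t => \sum_(n <- s) c n * unit_exp (t * (k * n)%:~R)).
by apply: sqintegrable_sum => n _; apply: sqintegrableZ; exact: sqintegrable_unit_exp.
Qed.

(* Avoids proving the measurability of the essential supremum over x: the
   integral of a nonnegative function is the supremum of the integrals of the
   simple functions below it. *)
Lemma ge0_le_integralT d (T : measurableType d) (nu : {measure set T -> \bar R})
    (u v : T -> \bar R) :
  (forall y, 0 <= u y)%E -> (forall y, u y <= v y)%E ->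
  (\int[nu]_x u x <= \int[nu]_x v x)%E.
Proof.
move=> u0 uv; rewrite !ge0_integralTE// => [|x]; last exact: le_trans (uv x).
apply: le_ereal_sup => _ [h hu <-]; exists h => // x.
exact: le_trans (hu x) (uv x).
Qed.

(** A bound valid at every [x] controls the essential supremum for each [t], leaving only the
    integrable majorant [Q] to integrate. *)
Lemma norm_L2t_Linftyx_le (F : R -> R -> R[i]) (Q : R -> R) :
  mu.-integrable setT (EFin \o Q) ->
  (forall x t, normc (F x t) ^+ 2 <= Q t) ->
  (norm_L2t_Linftyx F <= (Num.sqrt (\int[mu]_t Q t))%:E)%E.
Proof.
move=> iQ FQ; have Q0 t : 0 <= Q t by apply: le_trans (FQ 0 t); exact: sqr_ge0.
pose n t := ('N[mu]_(+oo) [(fun x => (normc (F x t))%:E)])%E.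
have n0 t : (0 <= n t)%E by exact: Lnorm_ge0.
have supQ t : (n t <= (Num.sqrt (Q t))%:E)%E.
  rewrite /n unlock torus_measure_setT lte01; apply/ess_supP; apply: nearW => x /=.
  by rewrite lee_fin -sqrtr_sqr ler_wsqrtr.
rewrite -[norm_L2t_Linftyx F]/('N[mu]_(2%:E) [n])%E; clearbody n; rewrite unlock.
rewrite -powR12_sqrt ?Rintegral_ge0// -poweR_EFin.
apply: gt0_ler_poweR; first by rewrite invr_ge0.
- by rewrite in_itv/= leey andbT integral_ge0// => t _; exact: poweR_ge0.
- by rewrite in_itv/= leey andbT lee_fin Rintegral_ge0.
rewrite /Rintegral fineK; last exact: integrable_fin_num.
apply: ge0_le_integralT => t; first exact: poweR_ge0.
rewrite gee0_abs//.
apply: (@le_trans _ _ (((Num.sqrt (Q t))%:E) `^ 2)%E).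
  apply: gt0_ler_poweR => //; first by rewrite in_itv/= leey andbT.
  by rewrite in_itv/= leey andbT lee_fin sqrtr_ge0.
by rewrite poweR_EFin powR_mulrn ?sqrtr_ge0// sqr_sqrtr.
Qed.

Lemma norm_L2t_Linftyx_kernel N (G : int -> int -> R[i]) (B : R) :
  1 <= N ->
  \sum_(m <- freqs N) \sum_(n <- freqs N) normc (G m n) ^+ 2 <= B ->
  (norm_L2t_Linftyx (fun x t => \sum_(m <- freqs N) \sum_(n <- freqs N)
     G m n * (wave m x t * (wave n x t)^*))%R <= (Num.sqrt (10 * N * B))%:E)%E.
Proof.
move=> N1 GB; pose S := freqs N; pose D := freqs (2 * N).
(* [g h] is the [h]-th diagonal of [G] extended by 0, [W h] its trigonometric sum in [t], and [q h]
   its squared l^2 norm. *)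
pose g h n := if n + h \in S then G (n + h) n else 0.
pose W h t := \sum_(n <- S) g h n * unit_exp (t * (2 * h * n)%:~R).
pose q h := \sum_(n <- S) normc (g h n) ^+ 2.
have q0 h : 0 <= q h by apply: sumr_ge0 => n _; exact: sqr_ge0.
have sum_q : \sum_(h <- D) q h <= B.
  apply: le_trans GB; rewrite exchange_big/= [leRHS]exchange_big/=.
  rewrite big_seq [leRHS]big_seq; apply: ler_sum => n nS.
  rewrite (sum_freqs_shift _ nS); apply: ler_sum => h _.
  by rewrite /g (fun_if (@normc R)) (fun_if (fun r => r ^+ 2)) normc0 expr0n.
(* The factor containing [x] comes out of each sum over [n] and has modulus 1, so the bound is
   uniform in [x]. *)
have FW x t : normc (\sum_(m <- S) \sum_(n <- S)
    G m n * (wave m x t * (wave n x t)^*)) <= \sum_(h <- D) normc (W h t).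
  rewrite exchange_big/= big_seq.
  under eq_bigr => n nS do rewrite (sum_freqs_shift _ nS).
  rewrite -big_seq exchange_big/=; apply: le_trans (normc_sum _ _ _) _.
  apply: ler_sum => h _.
  rewrite -[leRHS]mul1r -(normc_unit_exp (x * h%:~R + t * h%:~R ^+ 2)) -normcM.
  rewrite mulr_sumr le_eqVlt; apply/orP; left; apply/eqP; congr normc.
  apply: eq_bigr => n _; rewrite /g; case: ifP => _; last by rewrite mul0r mulr0.
  by rewrite wave_mulJ mulrCA.
have D0 : 0 \in D by rewrite mem_freqs; apply/andP; split; lra.
pose D' := [seq h <- D | h != 0].
have sumD (u : int -> R) : \sum_(h <- D) u h = u 0 + \sum_(h <- D') u h.
  by rewrite (bigD1_seq _ D0 (uniq_freqs _)) big_filter.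
(* The index h = 0 is split off before applying Cauchy-Schwarz: W 0 does not
   oscillate in t, so its weight must be size S alone. *)
pose Q t := (2 * (size S)%:R * q 0) * 1 +
  (2 * (size D)%:R) * \sum_(h <- D') normc (W h t) ^+ 2.
have FQ x t : normc (\sum_(m <- S) \sum_(n <- S)
    G m n * (wave m x t * (wave n x t)^*)) ^+ 2 <= Q t.
  have W0 : normc (W 0 t) ^+ 2 <= (size S)%:R * q 0.
    rewrite /W; under eq_bigr do rewrite mulr0 mul0r mulr0 unit_exp0 mulr1.
    apply: le_trans (sqr_sum_le _ _).
    by rewrite ler_pXn2r ?nnegrE ?normc_ge0 ?normc_sum// sumr_ge0// => *; exact: normc_ge0.
  have W' : (\sum_(h <- D') normc (W h t)) ^+ 2 <=
      (size D)%:R * \sum_(h <- D') normc (W h t) ^+ 2.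
    apply: le_trans (sqr_sum_le _ _) _; apply: ler_wpM2r.
      by apply: sumr_ge0 => *; exact: sqr_ge0.
    by rewrite ler_nat size_filter count_size.
  have := FW x t; rewrite sumD /Q.
  have := normc_ge0 (\sum_(m <- S) \sum_(n <- S)
    G m n * (wave m x t * (wave n x t)^*)).
  move: (normc (\sum_(m <- S) _)) => F F0 Fle.
  move: (normc (W 0 t)) (\sum_(h <- D') normc (W h t)) W0 W' Fle => u v.
  rewrite mulr1 -!mulrA => u2 v2 Fuv.
  (* The inequality [(u + v)^2 <= 2 u^2 + 2 v^2] is the source of the factors 2 in [Q]. *)
  apply: (@le_trans _ _ (2 * u ^+ 2 + 2 * v ^+ 2)); last by rewrite lerD// ler_pM2l.
  have : F ^+ 2 <= (u + v) ^+ 2 by rewrite ler_pXn2r ?nnegrE// (le_trans F0).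
  by have := sqr_ge0 (u - v); rewrite sqrrB sqrrD; lra.
have PW h : h \in D' -> mu.-integrable setT (EFin \o (fun t => normc (W h t) ^+ 2)) /\
    \int[mu]_t (normc (W h t) ^+ 2) = q h.
  rewrite mem_filter => /andP[h0 _].
  by apply: Rintegral_sqr_normc_lincomb; rewrite ?uniq_freqs// mulf_neq0.
have [iW IW] : mu.-integrable setT (EFin \o (fun t => \sum_(h <- D') normc (W h t) ^+ 2)) /\
    \int[mu]_t (\sum_(h <- D') normc (W h t) ^+ 2) = \sum_(h <- D') q h.
  elim: (D') PW => [_|h s IH Ws].
    have -> : (fun t => \sum_(h <- [::]) normc (W h t) ^+ 2) = (fun=> 0).
      by apply/funext => t; rewrite big_nil.
    rewrite big_nil; split; [exact: integrable0|by rewrite /Rintegral /= integral0].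
  have [ih Ih] := Ws h (mem_head _ _).
  have [is_ Is] := IH (fun k ks => Ws k (mem_behead (s := h :: s) ks)).
  rewrite big_cons -Is -Ih; split.
    have -> : (fun t => \sum_(k <- h :: s) normc (W k t) ^+ 2) =
        (fun t => normc (W h t) ^+ 2 + \sum_(k <- s) normc (W k t) ^+ 2).
      by apply/funext => t; rewrite big_cons.
    exact: (integrableD measurableT ih is_).
  rewrite -RintegralD//; apply: eq_Rintegral => t _; exact: big_cons.
have i1 : mu.-integrable setT (EFin \o (fun=> 1 : R)).
  apply/integrableP; split; first exact: measurable_cst.
  by rewrite integral_cst//= normr1 mul1e torus_measure_setT ltry.
apply: le_trans (norm_L2t_Linftyx_le (integrable_lincomb _ _ i1 iW) FQ) _.
rewrite lee_fin ler_wsqrtr// Rintegral_lincomb// Rintegral_cst// torus_measure_setT.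
rewrite IW /= !mulr1; have := sumD q; move: sum_q => /[swap] ->.
(* As [N >= 1], both [2 N + 1] and [4 N + 1] are at most [5 N]; with the factors 2 in [Q] this gives
   the constant 10. *)
have sS : (size S)%:R <= 5 * N by have := @size_freqs R N; rewrite /S; lra.
have sD : (size D)%:R <= 5 * N by have := @size_freqs R (2 * N); rewrite /D; lra.
have : 0 <= \sum_(h <- D') q h by apply: sumr_ge0.
move: (\sum_(h <- D') q h) (q 0) (q0 0) sS sD => p r r0.
move: (size S)%:R (size D)%:R => s d sN dN p0 prB.
by nra.
Qed.

End mixed_norm_bound.

(** * Sequence norms and the estimate for exponents at most 2 *)

Section sequence_norms.
Context {R : realType}.
Implicit Types (J : set nat) (lambda : nat -> R[i]).

(** With [L] the l^r norm, every [e_j <= L], so [e_j^2 = e_j^r e_j^(2 - r) <= e_j^r L^(2 - r)];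
    summing gives [L^r L^(2 - r) = L^2]. *)
Lemma sum_sqr_le_ell_norm (alpha : \bar R) J lambda :
  (1 <= alpha <= 2%:E)%E -> (ell_norm alpha J lambda < +oo)%E ->
  forall M, \sum_(0 <= j < M | j \in J) normc (lambda j) ^+ 2 <=
    fine (ell_norm alpha J lambda) ^+ 2.
Proof.
case: alpha => [r| |]; rewrite ?leye_eq ?leeNy_eq ?andbF// !lee_fin => /andP[r1 r2].
have r0 : 0 < r by exact: lt_le_trans r1.
pose e j : R := if j \in J then normc (lambda j) else 0.
have e0 j : 0 <= e j by rewrite /e; case: ifP => // _; exact: normc_ge0.
have e0r j : (0 <= `|(e j)%:E| `^ r)%E by exact: poweR_ge0.
rewrite /ell_norm Lnorm_counting//.
set T := (\sum_(k <oo) _)%E => Ty M.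
have T0 : (0 <= T)%E by apply: nneseries_ge0 => *; exact: e0r.
have Tfin : T \is a fin_num.
  by rewrite ge0_fin_numE//; apply: lty_poweRy Ty; rewrite invr_eq0 gt_eqF.
have sum_le m : \sum_(0 <= j < m) e j `^ r <= fine T.
  rewrite -lee_fin fineK// -sumEFin.
  apply: le_trans (nneseries_lim_ge m (fun k _ _ => e0r k)).
  rewrite le_eqVlt; apply/orP; left; apply/eqP; apply: eq_bigr => j _.
  by rewrite /= ger0_norm.
rewrite -(fineK Tfin) poweR_EFin [fine _%:E]/=.
move: (fine T) (fine_ge0 T0) sum_le => S S0 sum_le.
set L := S `^ r^-1.
have LS : L `^ r = S by rewrite -powRrM mulVf ?powRr1// gt_eqF.
have eL j : e j <= L.
  have : e j `^ r <= S.
    apply: le_trans (sum_le j.+1); rewrite big_nat_recr//= lerDr.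
    by apply: sumr_ge0 => *; exact: powR_ge0.
  move=> /(ge0_ler_powR (r := r^-1)).
  rewrite invr_ge0 ltW// -powRrM mulfV ?gt_eqF// powRr1//.
  by apply; rewrite ?nnegrE ?powR_ge0.
(* The splitting also holds at [y = 0], because the exponents add up to 2, which is nonzero. *)
have split2 y : 0 <= y -> y ^+ 2 = y `^ r * y `^ (2 - r).
  move=> y0; rewrite -powRD; last by rewrite addrC subrK pnatr_eq0.
  by rewrite addrC subrK powR_mulrn.
rewrite big_mkcond/= split2 ?powR_ge0// LS.
apply: (@le_trans _ _ (\sum_(0 <= j < M) e j `^ r * L `^ (2 - r))).
  apply: ler_sum => j _; have -> : (if j \in J then normc (lambda j) ^+ 2 else 0) = e j ^+ 2.
    by rewrite /e; case: ifP => // _; rewrite expr0n.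
  rewrite split2//; apply: ler_wpM2l; first exact: powR_ge0.
  by apply: ge0_ler_powR; rewrite ?nnegrE ?subr_ge0 ?powR_ge0.
by rewrite -mulr_suml; apply: ler_wpM2r; [exact: powR_ge0|exact: sum_le].
Qed.

(** The kernel bound with [B] the squared norm of [lambda] gives the factor [sqrt (10 N)]; the
    constant 4 works since [10 <= 16]. *)
Lemma maximal_estimate_le2 (alpha : \bar R) :
  (1 <= alpha <= 2%:E)%E -> maximal_estimate alpha.
Proof.
move=> a12; exists 4 => // N J lambda f N1 lfin of_.
have l0 : (0 <= ell_norm alpha J lambda)%E by exact: Lnorm_ge0.
have [G [dE GB]] := density_kernel_limit of_ N (sum_sqr_le_ell_norm a12 lfin).
have -> : density N J lambda f = (fun x t => \sum_(m <- freqs N)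
    \sum_(n <- freqs N) G m n * (wave m x t * (wave n x t)^*)).
  by apply/funext => x; apply/funext => t.
apply: le_trans (norm_L2t_Linftyx_kernel (ltW N1) GB) _.
have lE : ell_norm alpha J lambda = (fine (ell_norm alpha J lambda))%:E.
  by rewrite fineK// ge0_fin_numE.
rewrite [in X in (_ <= X)%E]lE -EFinM lee_fin.
have N0 : 0 <= N by rewrite (le_trans ler01)// ltW.
move: (fine _) (fine_ge0 l0) => L L0 {lE}.
rewrite sqrtrM ?mulr_ge0// sqrtr_sqr ger0_norm// ler_wpM2r//.
rewrite sqrtrM// ler_wpM2r ?sqrtr_ge0//.
by rewrite -[leRHS]ger0_norm// -sqrtr_sqr ler_wsqrtr// expr2; lra.
Qed.

End sequence_norms.

(** * Plane waves *)

Section pure_waves.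
Context {R : realType}.
Local Notation mu := (@torus_measure R).

Let purewave (j : nat) (x : R) : R[i] := unit_exp (x * j%:Z%:~R).

(** Index 0 is included, so the cut-off at [N = K] retains [K + 1] waves. *)
Let J (K : nat) : set nat := [set j | (j <= K)%N].

Let mem_J K j : (j \in J K) = (j < K.+1)%N.
Proof. by apply/idP/idP => [/set_mem|h]; rewrite ?inE. Qed.

Lemma orthonormal_system_pure_waves K : orthonormal_system (J K) purewave.
Proof.
split=> [j _|j k _ _]; last exact: torus_inner_unit_exp.
have [mr mi _] := sqintegrable_unit_exp (j%:Z%:~R : R).
split=> // [x|]; first by rewrite /purewave mulrDl unit_expD mul1r unit_exp_int mulr1.
under eq_Lnorm do rewrite normc_unit_exp.
by rewrite Lnorm_cst1 torus_measure_setT poweR1r ltry.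
Qed.

(** Each wave survives the cut-off and keeps modulus 1 under the evolution, so every [j <= K]
    contributes 1. *)
Lemma density_pure_waves (K : nat) x t :
  density K%:R (J K) (fun=> 1) purewave x t = K.+1%:R.
Proof.
apply: climnE; apply: ccvg_near_cst; near=> M.
have KM : (K.+1 <= M)%N by near: M; exact: nbhs_infty_ge.
rewrite (eq_bigl (fun j => (j < K.+1)%N)) => [|j]; last exact: mem_J.
rewrite -(big_nat_widen 0 K.+1 M xpredT)//.
rewrite big_nat (eq_bigr (fun=> 1)) => [|j /andP[_ jK]].
  by rewrite -big_nat big_const_nat subn0 iter_addr_0.
rewrite mul1r schrodinger_cutoff.
have jN : (j%:Z) \in freqs (K%:R : R).
  rewrite mem_freqs -[j%:Z%:~R]/(j%:R) ler_nat -ltnS jK andbT.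
  by rewrite (@le_trans _ _ 0)// oppr_le0.
rewrite (bigD1_seq _ jN (uniq_freqs _))/= big1 ?addr0 => [|n nj].
  rewrite fourier_coefE [torus_inner _ _]torus_inner_unit_exp eqxx mul1r.
  by rewrite normCK mulc_conj normc_unit_exp expr1n.
rewrite fourier_coefE [torus_inner _ _]torus_inner_unit_exp eq_sym.
by rewrite (negbTE nj) mul0r.
Unshelve. all: by end_near. Qed.

Lemma norm_L2t_Linftyx_cst (c : R[i]) :
  norm_L2t_Linftyx (fun _ _ : R => c) = (normc c)%:E.
Proof.
rewrite /norm_L2t_Linftyx unlock torus_measure_setT lte01.
have -> : abse \o (fun _ : R => (normc c)%:E) = cst (normc c)%:E.
  by apply/funext => x /=; rewrite ger0_norm ?normc_ge0.
rewrite ess_sup_cst ?torus_measure_setT ?lte01//.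
rewrite integral_cst// torus_measure_setT mule1 poweR_EFin -powRrM.
by rewrite mulfV ?pnatr_eq0// powRr1// !ger0_norm ?normc_ge0.
Qed.

(** Testing on plane waves with [N = K] gives [K + 1 <= C sqrt K (K + 1)^s], hence
    [(K + 1)^(1/2 - s) <= C], which fails for large [K]. The exponent [s] stands for [1 / alpha],
    with [s = 0] for [alpha = +oo]. *)
Lemma not_maximal_estimate_of_small_norm (alpha : \bar R) (s : R) :
  s < 2^-1 ->
  (forall K, (ell_norm alpha (J K) (fun=> 1%R) <= (K.+1%:R `^ s)%:E)%E) ->
  ~ maximal_estimate alpha.
Proof.
move=> s2 small [C C0 est].
have estK K : (1 < K)%N -> K.+1%:R `^ (2^-1 - s) <= C :> R.
  move=> K1; have K1R : 1 < K%:R :> R by rewrite ltr1n.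
  have fin : (ell_norm alpha (J K) (fun=> 1%R) < +oo)%E.
    exact: le_lt_trans (small K) (ltry _).
  have := est K%:R (J K) (fun=> 1) purewave K1R fin (orthonormal_system_pure_waves K).
  have -> : density K%:R (J K) (fun=> 1) purewave = (fun _ _ => K.+1%:R).
    by apply/funext => x; apply/funext => t; exact: density_pure_waves.
  rewrite norm_L2t_Linftyx_cst => le1.
  have : ((normc (K.+1%:R : R[i]))%:E <= (C * Num.sqrt K%:R)%:E * (K.+1%:R `^ s)%:E)%E.
    apply: le_trans le1 _; apply: lee_wpmul2l (small K).
    by rewrite lee_fin mulr_ge0 ?sqrtr_ge0// ltW.
  have -> : normc (K.+1%:R : R[i]) = K.+1%:R by rewrite (@normcMn R 1) normc1.
  rewrite -EFinM lee_fin => le2.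
  have K0 : 0 < K.+1%:R :> R by rewrite ltr0n.
  rewrite powRB ?gt_eqF// ?implybT// ler_pdivrMr ?powR_gt0//.
  rewrite powR12_sqrt ?ler0n//.
  rewrite -(ler_pM2l (_ : 0 < Num.sqrt K.+1%:R)) ?sqrtr_gt0//.
  rewrite -expr2 sqr_sqrtr ?ler0n//; apply: le_trans le2 _.
  rewrite [leRHS]mulrCA mulrA ler_wpM2r ?powR_ge0//.
  by rewrite ler_wpM2l ?(ltW C0)// ler_wsqrtr// ler_nat.
have d0 : 0 < 2^-1 - s by rewrite subr_gt0.
(* This makes [K + 1] exceed [C^(1 / (1/2 - s))]; adding 2 to the integer part also ensures
   [1 < K]. *)
pose K := (Num.truncn (C `^ (2^-1 - s)^-1)).+2.
have := estK K isT; apply/negP; rewrite -ltNge.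
have {1}-> : C = (C `^ (2^-1 - s)^-1) `^ (2^-1 - s).
  by rewrite -powRrM mulVf ?gt_eqF// powRr1// ltW.
apply: gt0_ltr_powR; rewrite ?nnegrE ?powR_ge0//.
apply: (@lt_le_trans _ _ (Num.truncn (C `^ (2^-1 - s)^-1)).+1%:R).
  exact: truncnS_gt.
by rewrite ler_nat /K; lia.
Qed.

Lemma ell_norm_pure_waves (r : R) K : 0 < r ->
  ell_norm r%:E (J K) (fun=> 1%R) = (K.+1%:R `^ r^-1)%:E.
Proof.
move=> r0; rewrite /ell_norm Lnorm_counting//.
(* From index [K + 1] on the terms are powers of 0, which vanish because the exponent [r] is
   positive. *)
rewrite (nneseries_split _ K.+1) => [|k _]; last exact: poweR_ge0.
rewrite add0n [X in (_ + X)%E]eseries0 => [|k Kk _].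
  rewrite adde0 big_nat (eq_bigr (fun=> 1%:E)) => [|j /andP[_ jK]].
    by rewrite -big_nat sumEFin big_const_nat subn0 iter_addr_0.
  by rewrite mem_J jK normc1 /= normr1 powR1.
by rewrite mem_J ltnNge Kk /= normr0 powR0// gt_eqF.
Qed.

Lemma ell_norm_infty_pure_waves K :
  (ell_norm +oo (J K) (fun=> 1%R : R[i]) <= 1)%E.
Proof.
rewrite /ell_norm unlock; case: ifP => // _; apply/ess_supP; apply: nearW => j.
by rewrite /comp; case: ifP => _; rewrite ?normc1 /= lee_fin ?normr1 ?normr0.
Qed.

Lemma not_maximal_estimate_gt2 (alpha : \bar R) :
  (2%:E < alpha)%E -> ~ maximal_estimate alpha.
Proof.
case: alpha => [r| |]//.
- rewrite lte_fin => r2; have r0 : 0 < r by exact: lt_trans r2.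
  apply: (@not_maximal_estimate_of_small_norm _ r^-1).
    by rewrite ltf_pV2 ?posrE.
  by move=> K; rewrite ell_norm_pure_waves.
- move=> _; apply: (@not_maximal_estimate_of_small_norm _ 0) => [|K].
    by rewrite invr_gt0.
  by rewrite powRr0; exact: ell_norm_infty_pure_waves.
Qed.

End pure_waves.

Theorem theorem1p6 (R : realType) (alpha : \bar R) (halpha : (1 <= alpha)%E) :
  ((alpha <= 2%:E)%E -> maximal_estimate alpha) /\
  ((2%:E < alpha)%E -> ~ maximal_estimate alpha).
Proof.
split=> [alpha2|]; last exact: not_maximal_estimate_gt2.
by apply: maximal_estimate_le2; rewrite halpha.
Qed.
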